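(* Let $\rho$ be a polymatroid on a finite set $E$. Then $\rho$ is Boolean if and only if there is a transversal matroid $M$ and a map $\phi:E\to\mathcal{Z}_M$ with $\rho(X)=r_M\bigl(\bigcup_{i\in X}\phi(i)\bigr)$ for all $X\subseteq E$.
   Context: A polymatroid on a finite set $E$ is a function $\rho:2^E\to\mathbb{R}$ with $\rho(\emptyset)=0$, monotone and submodular. A polymatroid $\rho$ on $E$ is Boolean if there are matroids $M_1,\ldots,M_k$ on $E$, each of rank at most $1$, with $\rho(X)=r_{M_1}(X)+\cdots+r_{M_k}(X)$ for all $X\subseteq E$. For a matroid $M$, $\mathcal{Z}_M$ is its set of cyclic flats, i.e., flats that are unions of circuits. *)

(* Defs.v *)
From HB Require Import structures.
From mathcomp Require Import all_boot all_order all_algebra.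
From mathcomp Require Import reals.

Set Implicit Arguments.
Unset Strict Implicit.
Unset Printing Implicit Defensive.

Import Order.TTheory GRing.Theory Num.Theory.

Section Matroid.

Variable T : finType.

Record matroid := Matroid {
  indep : {set {set T}};
  indep0 : set0 \in indep;
  indepS : forall I J : {set T}, I \subset J -> J \in indep -> I \in indep;
  indep_aug : forall I J : {set T}, I \in indep -> J \in indep -> #|I| < #|J| ->
    exists2 x, x \in J :\: I & x |: I \in indep
}.

Variable M : matroid.

Definition mrank (X : {set T}) : nat :=
  \max_(I in indep M | I \subset X) #|I|.

Definition circuits : {set {set T}} :=
  [set C | minset (fun D : {set T} => D \notin indep M) C].

Definition mclosure (X : {set T}) : {set T} :=
  [set x | mrank (x |: X) == mrank X].

Definition flats : {set {set T}} := [set F | mclosure F == F].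

Definition cyclic_flats : {set {set T}} :=
  [set F in flats | [exists P : {set {set T}},
                       (P \subset circuits) && (F == cover P)]].

End Matroid.

(* The matching is defined on the elements of X only, so that the empty set is
   a partial transversal of the empty family (k = 0) even if T is inhabited. *)
Definition partial_transversal (T : finType) (k : nat) (A : 'I_k -> {set T})
    (X : {set T}) : Prop :=
  exists f : {x : T | x \in X} -> 'I_k,
    injective f /\ forall x, val x \in A (f x).

Definition transversal_matroid (T : finType) (M : matroid T) : Prop :=
  exists (k : nat) (A : 'I_k -> {set T}),
    forall X : {set T}, X \in indep M <-> partial_transversal A X.

Local Open Scope ring_scope.

Definition polymatroid (R : realType) (E : finType) (rho : {set E} -> R) :
    Prop :=
  [/\ rho set0 = 0,
      forall X Y : {set E}, X \subset Y -> rho X <= rho Y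
    & forall X Y : {set E}, rho (X :|: Y) + rho (X :&: Y) <= rho X + rho Y].

Definition boolean_polymatroid (R : realType) (E : finType)
    (rho : {set E} -> R) : Prop :=
  polymatroid rho /\
  exists (k : nat) (M : 'I_k -> matroid E),
    (forall i, (mrank (M i) [set: E] <= 1)%N) /\
    forall X : {set E}, rho X = \sum_(i < k) (mrank (M i) X)%:R.

(* Main.v *)
Require Import Defs.
From mathcomp Require Import all_boot all_order all_algebra.
From mathcomp Require Import reals.
From mathcomp Require Import zify.

(** A matroid of rank at most 1 is given by its set of non-loops, so a Boolean
    polymatroid counts the sets of a family [N_1, ..., N_k] that meet [X].

    Forwards, double each index [j] into a parallel pair: the direct sum of [k]
    copies of [U_{1,2}] is transversal, and the union of the pairs indexed by
    [{j | i \in N_j}] is a cyclic flat that serves as [phi i].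

    Backwards, let [A] present [M]. By the defect form of Hall's theorem, the
    rank of [X] is the minimum over [Y \subset X] of the number of sets [A_j]
    meeting [Y] plus [#|X :\: Y|]. If [X] is a union of circuits, then no
    element of [X] is a coloop of [M | X], so the minimum is attained only at
    [Y = X]. Thus on unions of cyclic flats the rank counts the sets [A_j] that
    are met. *)

Set Implicit Arguments.
Unset Strict Implicit.
Unset Printing Implicit Defensive.

(** * Matchings in bipartite graphs *)

Section Matching.

Variables T K : finType.
Implicit Types (G H : {set T * K}) (X Y : {set T}).

Definition nbr G Y : {set K} := [set j | [exists y in Y, (y, j) \in G]].

Lemma nbrP G Y j : reflect (exists2 y, y \in Y & (y, j) \in G) (j \in nbr G Y).
Proof. by rewrite inE; exact: exists_inP. Qed.

(** For [m = #|X|] this is Hall's condition on [X]; in general it is the defect condition for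
    matching [m] elements of [X]. It is a boolean property of the edge set [G], so that [minset]
    applies to it. *)
Definition defect_ge X (m : nat) G :=
  [forall Y : {set T}, (Y \subset X) ==> (m <= #|nbr G Y| + #|X :\: Y|)].

(** Deleting an edge of a minimal [H] breaks the bound at some [Y]. This [Y] contains [x], since
    otherwise the deletion would not affect the neighbours of [Y]. *)
Lemma minimal_defect_witness X m H x j :
  minset (defect_ge X m) H -> (x, j) \in H ->
  exists Y, [/\ x \in Y, Y \subset X &
                #|nbr (H :\ (x, j)) Y| + #|X :\: Y| < m].
Proof.
move=> /minsetP [HP Hmin] eH.
have : ~~ defect_ge X m (H :\ (x, j)).
  apply/negP => P'; have := Hmin _ P' (subsetDl _ _).
  by move=> E; move: eH; rewrite -E setD11.
case/forallPn => Y; rewrite negb_imply -ltnNge => /andP [YX lt].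
exists Y; split=> //; apply: contraLR lt => xY; rewrite -leqNgt.
have -> : nbr (H :\ (x, j)) Y = nbr H Y.
  apply/setP => i; apply/nbrP/nbrP => -[y yY]; first by case/setD1P; exists y.
  move=> yi; exists y => //; rewrite !inE yi andbT.
  by apply: contraNneq xY => -[<- _].
by move/forallP/(_ Y): HP; rewrite YX.
Qed.

(* Rado's argument: were two edges at [x] both essential, the two sets
   witnessing this would violate the bound by submodularity. *)
Lemma minimal_defect_functional X m H x j1 j2 :
  minset (defect_ge X m) H -> (x, j1) \in H -> (x, j2) \in H -> j1 = j2.
Proof.
move=> Hmin e1 e2; apply/eqP; apply/negPn/negP => n12.
have [Y1 [x1 s1 lt1]] := minimal_defect_witness Hmin e1.
have [Y2 [x2 s2 lt2]] := minimal_defect_witness Hmin e2.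
have /minsetP [/forallP HP _] := Hmin.
set N1 := nbr _ Y1 in lt1; set N2 := nbr _ Y2 in lt2.
(* The edge deleted for one set survives for the other, as [j1] and [j2] differ and [x] lies in both
   [Y1] and [Y2]. *)
have sU : nbr H (Y1 :|: Y2) \subset N1 :|: N2.
  apply/subsetP => i /nbrP [y yY yi].
  have [E1|E1] := eqVneq (y, i) (x, j1).
    case: E1 => Ey Ei; rewrite in_setU; apply/orP; right; apply/nbrP; exists x => //.
    by rewrite !inE Ei e1 andbT; apply: contraNneq n12 => -[->].
  have [E2|E2] := eqVneq (y, i) (x, j2).
    case: E2 => Ey Ei; rewrite in_setU; apply/orP; left; apply/nbrP; exists x => //.
    by rewrite !inE Ei e2 andbT; apply: contraNneq n12 => -[->].
  rewrite in_setU; case/setUP: yY => yY; apply/orP; [left|right];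
    by apply/nbrP; exists y => //; rewrite in_setD1 yi ?E1 ?E2.
have sI : nbr H ((Y1 :&: Y2) :\ x) \subset N1 :&: N2.
  apply/subsetP => i /nbrP [y /setD1P [yx /setIP [y1 y2]] yi].
  by rewrite in_setI; apply/andP; split; apply/nbrP; exists y => //;
    rewrite in_setD1 yi andbT; apply: contraNneq yx => -[->].
have sUX : Y1 :|: Y2 \subset X by rewrite subUset s1.
have sIX : Y1 :&: Y2 :\ x \subset X.
  by apply: subset_trans s1; apply: subset_trans (subsetDl _ _) (subsetIl _ _).
(* The two strict bounds sum to at most [2m - 2]. Dropping [x] from the intersection adds only 1 to
   the complements, so the bounds for [H] yield [2m <= 2m - 1]. *)
have := HP (Y1 :|: Y2); have := HP ((Y1 :&: Y2) :\ x); rewrite sUX sIX /=.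
have xI : x \in Y1 :&: Y2 by rewrite inE x1.
move: lt1 lt2 (subset_leq_card sU) (subset_leq_card sI) (cardsUI N1 N2).
move: (cardsUI Y1 Y2) (cardsD1 x (Y1 :&: Y2)); rewrite xI /=.
move: (subset_leq_card sUX) (subset_leq_card sIX).
move: (subset_leq_card s1) (subset_leq_card s2).
rewrite (cardsDS s1) (cardsDS s2) (cardsDS sUX) (cardsDS sIX).
move: (m) #|X| #|Y1| #|Y2| #|N1| #|N2| #|Y1 :|: Y2|.
move: #|nbr H (Y1 :|: Y2)| #|nbr H (Y1 :&: Y2 :\ x)|.
move: #|Y1 :&: Y2| #|Y1 :&: Y2 :\ x| #|N1 :|: N2| #|N1 :&: N2|.
clear; lia.
Qed.

(** Pass to a minimal edge set [H], where each element has at most one edge. Choosing for each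
    neighbour of [X] an element [h j] adjacent to it is then injective, and the bound at [Y = X]
    gives at least [m] neighbours. The matching is the inverse of [h] on its image. *)
Lemma defect_matching G X m : defect_ge X m G ->
  exists (I : {set T}) (f : {x : T | x \in I} -> K),
    [/\ I \subset X, m <= #|I|, injective f & forall x, (val x, f x) \in G].
Proof.
move=> Gm; have [H Hmin HG] := minset_exists Gm.
have fH x j1 j2 := @minimal_defect_functional X m H x j1 j2 Hmin.
have mN : m <= #|nbr H X|.
  have /minsetP [/forallP/(_ X)] := Hmin.
  by rewrite subxx setDv cards0 addn0.
pose h (j : {j : K | j \in nbr H X}) : T := s2val (sig2W (nbrP _ _ _ (valP j))).
have hX j : h j \in X by rewrite /h; case: sig2W.
have hH j : (h j, val j) \in H by rewrite /h; case: sig2W.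
pose I := [set h j | j in {: {j : K | j \in nbr H X}}].
have hI (x : {x : T | x \in I}) : exists j, h j == val x.
  by case/imsetP: (valP x) => j _ E; exists j; rewrite E.
pose f x := xchoose (hI x).
have fP x : h (f x) = val x by apply/eqP/(xchooseP (hI x)).
have h_inj : injective h.
  move=> j1 j2 E; apply/val_inj/(fH (h j1)); first exact: hH.
  by rewrite E; exact: hH.
exists I, (fun x => val (f x)); split.
- by apply/subsetP => _ /imsetP [j _ ->].
- by rewrite card_imset // card_sig.
- by move=> x y /val_inj E; apply: val_inj; rewrite -!fP E.
- by move=> x; rewrite -fP; apply: (subsetP HG).
Qed.

End Matching.

(** * Rank and circuits *)

Section Rank.

Variables (T : finType) (M : matroid T).
Implicit Types I J X : {set T}.

Lemma card_le_mrank I X : I \in indep M -> I \subset X -> #|I| <= mrank M X.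
Proof.
move=> iI sI.
by apply: (@leq_bigmax_cond _ _ (fun I : {set T} => #|I|)); rewrite iI.
Qed.

Lemma mrank_leP X m :
  (forall I, I \in indep M -> I \subset X -> #|I| <= m) -> mrank M X <= m.
Proof. by move=> h; apply/bigmax_leqP => I /andP [iI sI]; exact: h. Qed.

Lemma mrank_basis X :
  exists I, [/\ I \in indep M, I \subset X & #|I| = mrank M X].
Proof.
pose P I := (I \in indep M) && (I \subset X).
have P0 : 0 < #|P|.
  by apply/card_gt0P; exists set0; rewrite unfold_in /P (indep0 M) sub0set.
have [I /andP [iI sI] E] := eq_bigmax_cond (fun I : {set T} => #|I|) P0.
by exists I; split.
Qed.

Lemma indep_extend I X : I \in indep M -> I \subset X ->
  exists J, [/\ I \subset J, J \in indep M, J \subset X & #|J| = mrank M X].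
Proof.
move=> iI sI; pose P J := (J \in indep M) && (J \subset X).
have PI : P I by apply/andP.
have [J /maxsetP [/andP [iJ sJ] Jmax] IJ] := maxset_exists PI.
exists J; split=> //; apply/eqP; rewrite eqn_leq card_le_mrank //=.
have [B [iB sB <-]] := mrank_basis X; rewrite leqNgt; apply/negP => lt.
have [x /setDP [xB xJ] ixJ] := indep_aug iJ iB lt.
have := Jmax (x |: J); rewrite subsetUr => E; case/negP: xJ.
rewrite -E ?setU11 //; apply/andP; split=> //.
by rewrite subUset sJ sub1set (subsetP sB).
Qed.

(** Extend the independent set [C :\ x] to a basis of [X]; it avoids [x], since otherwise it would
    contain [C]. *)
Lemma circuit_not_coloop C X x : C \in circuits M -> C \subset X -> x \in C ->
  exists I, [/\ I \in indep M, I \subset X :\ x & #|I| = mrank M X].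
Proof.
rewrite inE => /minsetP [nC Cmin] CX xC.
have iC : C :\ x \in indep M.
  apply/negPn/negP => n; have := Cmin _ n (subsetDl _ _).
  by move=> E; move: xC; rewrite -E setD11.
have [J [sJ iJ JX cJ]] := indep_extend iC (subset_trans (subsetDl _ _) CX).
exists J; split=> //; apply/subsetD1P; split=> //.
apply: contraNN nC => xJ; apply: indepS iJ.
by rewrite -(setD1K xC) subUset sub1set xJ.
Qed.

End Rank.

(** * Rank of cyclic sets in transversal matroids *)

Section Transversal.

Variables (T : finType) (k : nat) (A : 'I_k -> {set T}) (M : matroid T).
Hypothesis MA : forall X, X \in indep M <-> partial_transversal A X.

Implicit Types I X Y : {set T}.

Definition met X : {set 'I_k} := [set j | X :&: A j != set0].

Let G : {set T * 'I_k} := [set e | e.1 \in A e.2].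

Lemma nbr_met X : nbr G X = met X.
Proof.
apply/setP => j; rewrite [RHS]inE; apply/nbrP/set0Pn.
  by case=> x xX; rewrite inE /= => xj; exists x; rewrite inE xX.
by case=> x /setIP [xX xj]; exists x; rewrite ?inE.
Qed.

Lemma indep_card_met I Y : I \in indep M -> I \subset Y -> #|I| <= #|met Y|.
Proof.
move=> /MA [f [f_inj fA]] sI; rewrite -card_sig -(card_codom f_inj).
apply/subset_leq_card/subsetP => _ /codomP [x ->]; rewrite inE; apply/set0Pn.
by exists (val x); rewrite inE fA (subsetP sI) // (valP x).
Qed.

(** If the defect condition held for [(mrank M X).+1], the resulting matching would give an
    independent subset of [X] larger than its rank. *)
Lemma mrank_defect X :
  exists2 Y : {set T}, Y \subset X & #|met Y| + #|X :\: Y| <= mrank M X.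
Proof.
have [D|] := boolP (defect_ge X (mrank M X).+1 G).
  have [I [f [sI cI f_inj fG]]] := defect_matching D.
  suff iI : I \in indep M by have := card_le_mrank iI sI; rewrite leqNgt cI.
  by apply/MA; exists f; split=> // x; have := fG x; rewrite inE.
case/forallPn => Y; rewrite negb_imply -ltnNge ltnS nbr_met => /andP [YX le].
by exists Y.
Qed.

Lemma mrank_cyclic (P : {set {set T}}) :
  P \subset circuits M -> mrank M (cover P) = #|met (cover P)|.
Proof.
move=> sP; apply/eqP; rewrite eqn_leq; apply/andP; split.
  by apply: mrank_leP => I; exact: indep_card_met.
have [Y YX le] := mrank_defect (cover P).
suff E : Y = cover P by move: le; rewrite E setDv cards0 addn0.
apply/eqP; rewrite eqEsubset YX; apply/subsetP => x xX.
apply/negPn/negP => xY; have /bigcupP [C CP xC] := xX.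
have CX : C \subset cover P by exact: bigcup_sup.
(* A basis avoiding [x] has at most [#|met Y|] elements in [Y] and at most [#|cover P :\: Y| - 1]
   outside it, which is less than the rank. *)
have [I [iI sI cI]] := circuit_not_coloop (subsetP sP _ CP) CX xC.
have i1 : #|I :&: Y| <= #|met Y|.
  by apply: indep_card_met (subsetIr _ _); apply: indepS iI; exact: subsetIl.
have i2 : #|I :\: Y| <= #|(cover P :\: Y) :\ x|.
  by rewrite setDDl setUC -setDDl subset_leq_card // setSD.
have := cardsD1 x (cover P :\: Y); rewrite inE xX xY /=.
move: i1 i2 le (cardsID Y I); rewrite cI; lia.
Qed.

End Transversal.

(** * Partition matroids with loops *)

Section Partition.

Variables (T K : finType) (D : {set T}) (g : T -> K).
Implicit Types I J X : {set T}.

(** Elements outside [D] are loops, and the fibres of [g] on [D] are the parallel classes. A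
    constant [g] gives rank at most 1, and [fst] gives the parallel pairs. *)
Definition part_indep : {set {set T}} :=
  [set I : {set T} | (I \subset D) && (#|g @: I| == #|I|)].

Lemma part_indepP I :
  reflect (I \subset D /\ {in I &, injective g}) (I \in part_indep).
Proof.
rewrite inE; apply: (iffP andP) => -[sI gI]; split=> //; exact/imset_injP.
Qed.

Lemma part_indep0 : set0 \in part_indep.
Proof. by rewrite inE sub0set imset0 !cards0. Qed.

Lemma part_indepS I J :
  I \subset J -> J \in part_indep -> I \in part_indep.
Proof.
move=> sIJ /part_indepP [sJ gJ]; apply/part_indepP; split.
  exact: subset_trans sJ.
exact: sub_in2 (subsetP sIJ) _ gJ.
Qed.

Lemma part_indepU1 I x :
  I \in part_indep -> x \in D -> g x \notin g @: I -> x |: I \in part_indep.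
Proof.
rewrite !inE => /andP [sI /eqP gI] xD gx.
rewrite subUset sub1set xD sI imsetU1 !cardsU1 gx gI /=.
by have -> : x \notin I by apply: contraNN gx; exact: imset_f.
Qed.

(** [J] represents more classes than [I] does, so some element of [J] lies in a class new to [I]. *)
Lemma part_indep_aug I J :
  I \in part_indep -> J \in part_indep -> #|I| < #|J| ->
  exists2 x, x \in J :\: I & x |: I \in part_indep.
Proof.
move=> iI; rewrite inE => /andP [sJ /eqP gJ] lt.
have : ~~ (g @: J \subset g @: I).
  apply/negP => /subset_leq_card; rewrite gJ leqNgt.
  by rewrite (leq_ltn_trans (leq_imset_card _ _) lt).
case/subsetPn => _ /imsetP [x xJ ->] gx; exists x.
  by rewrite inE xJ andbT; apply: contraNN gx; exact: imset_f.
by apply: part_indepU1 => //; exact: (subsetP sJ).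
Qed.

Definition part_matroid : matroid T :=
  Matroid part_indep0 part_indepS part_indep_aug.

Lemma mrank_part X : mrank part_matroid X = #|g @: (X :&: D)|.
Proof.
apply/eqP; rewrite eqn_leq; apply/andP; split.
  apply: mrank_leP => I; rewrite inE => /andP [sI /eqP <-] IX.
  by apply/subset_leq_card/imsetS; rewrite subsetI IX.
have [I [iI sI cI]] := mrank_basis part_matroid X; rewrite -cI.
suff sub : g @: (X :&: D) \subset g @: I.
  exact: leq_trans (subset_leq_card sub) (leq_imset_card _ _).
apply/subsetP => _ /imsetP [x /setIP [xX xD] ->]; apply/negPn/negP => gx.
have iU : x |: I \in indep part_matroid by exact: part_indepU1.
have sU : x |: I \subset X by rewrite subUset sub1set xX.
have xI : x \notin I by apply: contraNN gx; exact: imset_f.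
by have := card_le_mrank iU sU; rewrite -cI cardsU1 xI ltnn.
Qed.

End Partition.

(** * Matroids of rank at most one *)

Lemma card_imset_const (T : finType) (X : {set T}) :
  #|(fun=> tt) @: X| = (X != set0).
Proof.
have [->|[x xX]] := set_0Vmem X; first by rewrite imset0 cards0 eqxx.
have -> : X != set0 by apply/set0Pn; exists x.
rewrite /= -(cards1 tt); congr #|pred_of_set _|; apply/setP => -[].
by rewrite inE eqxx; apply/imsetP; exists x.
Qed.

Lemma mrank_le1 (T : finType) (M : matroid T) (X : {set T}) : mrank M [set: T] <= 1 ->
  mrank M X = (X :&: [set x | [set x] \in indep M] != set0).
Proof.
move=> M1; have [E|[x]] := set_0Vmem (X :&: [set x | [set x] \in indep M]).
  rewrite E eqxx; apply/eqP; rewrite -leqn0; apply: mrank_leP => I iI sI.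
  rewrite leqn0 cards_eq0; apply/eqP/setP => y; rewrite inE; apply/negP => yI.
  suff : y \in set0 by rewrite inE.
  rewrite -E inE (subsetP sI) //= inE.
  by apply: indepS iI; rewrite sub1set.
move=> xXN; have -> : X :&: [set x | [set x] \in indep M] != set0.
  by apply/set0Pn; exists x.
move: xXN; rewrite !inE => /andP [xX ix]; apply/eqP; rewrite eqn_leq /=.
rewrite -{2}(cards1 x) card_le_mrank ?sub1set // andbT.
apply: mrank_leP => I iI _; apply: leq_trans M1.
by apply: card_le_mrank => //; exact: subsetT.
Qed.

(** * Parallel pairs *)

Section Pairs.

Variable k : nat.

(** Without the doubling the matroid would be free, with the empty set as its only cyclic flat; the
    twin puts every element on a circuit. *)
Definition pair_matroid : matroid ('I_k * bool)%type :=
  part_matroid [set: 'I_k * bool] fst.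

Implicit Type S : {set 'I_k}.

Definition pairs S : {set 'I_k * bool} := [set t | t.1 \in S].

Lemma mrank_pair X : mrank pair_matroid X = #|fst @: X|.
Proof. by rewrite mrank_part setIT. Qed.

Lemma fst_pairs S : fst @: pairs S = S.
Proof.
apply/setP => j; apply/imsetP/idP => [[t + ->]|jS]; first by rewrite inE.
by exists (j, true); rewrite ?inE.
Qed.

(** The presenting sets are the disjoint pairs themselves, so a matching can only be the first
    projection. *)
Lemma pair_matroid_transversal : transversal_matroid pair_matroid.
Proof.
exists k, (fun j => [set t | t.1 == j]) => X; split.
  case/part_indepP => _ X_inj; exists (fun x => (val x).1); split.
    by move=> x y E; apply/val_inj/X_inj => //; exact: valP.
  by move=> x; rewrite inE.
case=> f [f_inj fA]; apply/part_indepP; split; first exact: subsetT.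
move=> x y xX yX E; pose x' : {x | x \in X} := exist _ x xX.
pose y' : {x | x \in X} := exist _ y yX.
suff : x' = y' by move/(congr1 val).
apply: f_inj; have := fA x'; have := fA y'; rewrite !inE /= E.
by move=> /eqP -> /eqP ->.
Qed.

Lemma pair_circuit (j : 'I_k) : pairs [set j] \in circuits pair_matroid.
Proof.
rewrite inE; apply/minsetP; split.
  apply/negP => /part_indepP [_ /(_ (j, true) (j, false))].
  by rewrite !inE eqxx => /(_ isT isT erefl).
move=> B nB sB; apply/eqP; rewrite eqEsubset sB /=.
apply/subsetP => -[i b]; rewrite !inE /= => /eqP -> {i}.
apply: contraNT nB => jb; apply/part_indepP; split; first exact: subsetT.
have inB t : t \in B -> t = (j, ~~ b).
  case: t => i c tB; have := subsetP sB _ tB; rewrite !inE /= => /eqP Ei.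
  move: tB jb; rewrite Ei; by case: c b => -[] // ->.
by move=> t u /inB -> /inB ->.
Qed.

(** An element outside [pairs S] brings a new index and raises the rank; each pair inside is a
    circuit. *)
Lemma pairs_cyclic_flat S : pairs S \in cyclic_flats pair_matroid.
Proof.
rewrite inE; apply/andP; split.
  rewrite inE; apply/eqP/setP => x; rewrite inE !mrank_pair.
  rewrite imsetU1 fst_pairs cardsU1 [x \in pairs S]inE.
  by case: (x.1 \in S); rewrite ?eqxx // add1n eqn_leq ltnn.
apply/existsP; exists [set pairs [set j] | j in S]; apply/andP; split.
  by apply/subsetP => _ /imsetP [j _ ->]; exact: pair_circuit.
apply/eqP/setP => t; rewrite inE; apply/idP/bigcupP => [tS|[C]].
  by exists (pairs [set t.1]); [exact: imset_f | rewrite !inE].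
by case/imsetP => j jS ->; rewrite !inE => /eqP ->.
Qed.

Lemma bigcup_pairs (E : finType) (X : {set E}) (S : E -> {set 'I_k}) :
  \bigcup_(i in X) pairs (S i) = pairs (\bigcup_(i in X) S i).
Proof.
apply/setP => t; rewrite inE; apply/bigcupP/bigcupP => -[i iX];
  by rewrite ?inE => it; exists i; rewrite ?inE.
Qed.

End Pairs.

(** A union of cyclic flats need not be a flat, but it is still a union of circuits, which is what
    [mrank_cyclic] asks for. *)
Lemma bigcup_cyclic (T E : finType) (M : matroid T) (phi : E -> {set T})
    (X : {set E}) :
  (forall i, phi i \in cyclic_flats M) ->
  exists2 P : {set {set T}}, P \subset circuits M
    & \bigcup_(i in X) phi i = cover P.
Proof.
move=> phiP; pose P := [set C in circuits M | [exists i in X, C \subset phi i]].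
exists P; first by apply/subsetP => C; rewrite inE => /andP [].
apply/setP => t; apply/bigcupP/bigcupP => -[].
  move=> i iX; have := phiP i; rewrite inE => /andP [_].
  case/existsP => Q /andP [sQ /eqP E_i]; rewrite E_i => /bigcupP [C CQ tC].
  exists C => //; rewrite inE (subsetP sQ) //=; apply/exists_inP; exists i => //.
  by rewrite E_i; exact: bigcup_sup.
move=> C; rewrite inE => /andP [_ /exists_inP [i iX sC]] tC.
by exists i => //; exact: (subsetP sC).
Qed.

Local Open Scope ring_scope.

Lemma natr_card_sum (R : realType) (k : nat) (S : {set 'I_k}) :
  (#|S|)%:R = \sum_(j < k) (j \in S)%:R :> R.
Proof.
rewrite -sum1_card GRing.natr_sum big_mkcond.
by apply: eq_bigr => j _; case: ifP.
Qed.

Theorem theorem2p7 (R : realType) (E : finType) (rho : {set E} -> R)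
  (rhoP : polymatroid rho) :
  boolean_polymatroid rho <->
  exists (T : finType) (M : matroid T) (phi : E -> {set T}),
    [/\ transversal_matroid M,
        forall i : E, phi i \in cyclic_flats M
      & forall X : {set E}, rho X = (mrank M (\bigcup_(i in X) phi i))%:R].
Proof.
split.
  case=> _ [k [Ms [Ms1 rhoE]]].
  (* [S i] collects the matroids in which [i] is not a loop, so [Ms j] has rank 1 on [X] exactly
     when [j] lies in some [S i] with [i] in [X]. *)
  pose S i : {set 'I_k} := [set j | [set i] \in indep (Ms j)].
  exists ('I_k * bool)%type, (pair_matroid k), (fun i => pairs (S i)); split.
  - exact: pair_matroid_transversal.
  - by move=> i; exact: pairs_cyclic_flat.
  move=> X; rewrite bigcup_pairs mrank_pair fst_pairs natr_card_sum rhoE.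
  apply: eq_bigr => j _; rewrite (mrank_le1 X (Ms1 j)); congr (nat_of_bool _)%:R.
  apply/set0Pn/bigcupP.
    by case=> i; rewrite !inE => /andP [iX ij]; exists i; rewrite ?inE.
  by case=> i iX; rewrite inE => ij; exists i; rewrite !inE iX.
case=> T [M [phi [[k [A MA]] phiP rhoE]]]; split=> //.
(* Each presenting set [A j] yields one matroid, with non-loops [N j]: the union of the [phi i] over
   [X] meets [A j] exactly when [X] meets [N j]. *)
pose N j : {set E} := [set i | phi i :&: A j != set0].
exists k, (fun j => part_matroid (N j) (fun=> tt)); split.
  by move=> j; rewrite mrank_part card_imset_const leq_b1.
move=> X; have [P sP PE] := bigcup_cyclic X phiP.
rewrite rhoE PE (mrank_cyclic MA sP) -PE natr_card_sum.
apply: eq_bigr => j _; rewrite mrank_part card_imset_const inE.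
congr (nat_of_bool _)%:R; apply/set0Pn/set0Pn.
  case=> t /setIP [/bigcupP [i iX ti] tj]; exists i; rewrite !inE iX.
  by apply/set0Pn; exists t; rewrite inE ti.
case=> i /setIP [iX]; rewrite inE => /set0Pn [t /setIP [ti tj]].
by exists t; rewrite inE tj andbT; apply/bigcupP; exists i.
Qed.
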